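(* Let $\mu_k:=\frac{B_{k+1}}{k+1}$ for $k\ge0$, where $B_k$ are the Bernoulli numbers. Then for all $n=0,1,2,\ldots$, $$H_n(\mu_k)=\det\left(\mu_{i+j}\right)_{0\le i,j\le n}\neq 0.$$
   Context: The Bernoulli numbers $B_k$ are defined by $\frac{t}{e^t-1}=\sum_{k\ge0}B_k\frac{t^k}{k!}$ (so $B_1=-1/2$). For a sequence $(c_k)_{k\ge0}$, $H_n(c_k):=\det(c_{i+j})_{0\le i,j\le n}$. *)

(* Defs.v *)
From mathcomp Require Import all_boot all_order all_algebra.

Set Implicit Arguments.
Unset Strict Implicit.
Unset Printing Implicit Defensive.

Import Order.TTheory GRing.Theory Num.Theory.
Local Open Scope ring_scope.

(* A formal power series is the sequence nat -> F of its coefficients. *)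

Definition fps_mul (F : fieldType) (f g : nat -> F) : nat -> F :=
  fun n => \sum_(i < n.+1) f (n - i)%N * g i.

(* The first n coefficients of the quotient g / f, for f 0 != 0: the m-th one
   is obtained by solving \sum_(i <= m) f (m - i) * c i = g m for c m. *)
Fixpoint fps_div_seq (F : fieldType) (g f : nat -> F) (n : nat) : seq F :=
  if n is m.+1 then
    let s := fps_div_seq g f m in
    rcons s ((g m - \sum_(i < m) f (m - i)%N * s`_i) / f 0%N)
  else [::].

Definition fps_div (F : fieldType) (g f : nat -> F) : nat -> F :=
  fun n => (fps_div_seq g f n.+1)`_n.

Definition fps_one : nat -> rat := fun n => (n == 0%N)%:R.
Definition fps_t : nat -> rat := fun n => (n == 1%N)%:R.
(* e^t - 1 *)
Definition fps_expm1 : nat -> rat :=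
  fun n => if n is 0 then 0 else (n`!)%:R^-1.
(* (e^t - 1) / t *)
Definition fps_expm1_over_t : nat -> rat := fun n => fps_expm1 n.+1.

(* t / (e^t - 1) = 1 / ((e^t - 1) / t) = \sum_k B_k t^k / k!, with
   e^t - 1 divided by t first to make its constant term invertible;
   in particular B_1 = -1/2 (not 1/2). *)
Definition bernoulli (k : nat) : rat :=
  (k`!)%:R * fps_div fps_one fps_expm1_over_t k.

Definition egf (B : nat -> rat) : nat -> rat := fun k => B k / (k`!)%:R.

(* The matrix has size n + 1: its indices run over 0, ..., n. *)
Definition hankel_det (F : fieldType) (c : nat -> F) (n : nat) : F :=
  \det (\matrix_(i < n.+1, j < n.+1) c (i + j)%N).

Definition mu (k : nat) : rat := bernoulli k.+1 / k.+1%:R.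

Lemma size_fps_div_seq (F : fieldType) (g f : nat -> F) n :
  size (fps_div_seq g f n) = n.
Proof. by elim: n => //= n IH; rewrite size_rcons IH. Qed.

Lemma nth_fps_div_seq (F : fieldType) (g f : nat -> F) n i :
  (i < n)%N -> (fps_div_seq g f n)`_i = fps_div g f i.
Proof.
elim: n => // n IH; rewrite ltnS leq_eqVlt => /orP[/eqP -> // | lt_in].
by rewrite /= nth_rcons size_fps_div_seq lt_in IH.
Qed.

Lemma fps_divE (F : fieldType) (g f : nat -> F) n :
  fps_div g f n = (g n - \sum_(i < n) f (n - i)%N * fps_div g f i) / f 0%N.
Proof.
rewrite {1}/fps_div /= nth_rcons size_fps_div_seq ltnn eqxx.
by congr ((_ - _) / _); apply: eq_bigr => i _; rewrite nth_fps_div_seq.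
Qed.

Lemma fps_divK (F : fieldType) (g f : nat -> F) :
  f 0%N != 0 -> fps_mul f (fps_div g f) =1 g.
Proof.
move=> f0 n; rewrite /fps_mul big_ord_recr /= subnn [fps_div _ _ n]fps_divE.
by rewrite mulrCA mulfV // mulr1 addrC subrK.
Qed.

Lemma fps_mul_expm1 (g : nat -> rat) n :
  fps_mul fps_expm1 g n =
  if n is m.+1 then fps_mul fps_expm1_over_t g m else 0.
Proof.
case: n => [|m]; first by rewrite /fps_mul big_ord1 mul0r.
rewrite /fps_mul big_ord_recr /= subnn mul0r addr0.
by apply: eq_bigr => i _; rewrite /fps_expm1_over_t subSn // -ltnS.
Qed.

Lemma bernoulli_egf : fps_mul fps_expm1 (egf bernoulli) =1 fps_t.
Proof.
case=> [|m]; rewrite fps_mul_expm1 //.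
have e0 : fps_expm1_over_t 0%N != 0 by [].
rewrite [RHS](_ : _ = fps_one m) // -(fps_divK fps_one e0).
apply: eq_bigr => i _; congr (_ * _).
by rewrite /egf /bernoulli mulrC mulKf // pnatr_eq0 -lt0n fact_gt0.
Qed.

Lemma bernoulli_unique (B : nat -> rat) :
  fps_mul fps_expm1 (egf B) =1 fps_t -> B =1 bernoulli.
Proof.
move=> eB n; elim/ltn_ind: n => n IH.
have := etrans (eB n.+1) (esym (bernoulli_egf n.+1)).
rewrite !fps_mul_expm1 /fps_mul !big_ord_recr /= subnn.
rewrite (eq_bigr (fun i : 'I_n => fps_expm1_over_t (n - i)%N * egf bernoulli i)).
  move/addrI; have -> : fps_expm1_over_t 0%N = 1 by [].
  rewrite !mul1r /egf => /(congr1 (fun x => x * (n`!)%:R)).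
  by rewrite !divfK // pnatr_eq0 -lt0n fact_gt0.
by move=> i _; rewrite /egf IH.
Qed.

Lemma bernoulli1 : bernoulli 1 = - 2%:R^-1.
Proof.
by rewrite /bernoulli /fps_div /= !big_ord_recr !big_ord0.
Qed.

(* Main.v *)
(* As B_k = 0 for odd k >= 3, the Hankel matrix of mu splits by the parity of
   its indices: its kernel vanishes as soon as the matrices
   (B_{2d} / 2d) with d = i + j + 1, resp. d = i + j + 2, have trivial kernel.
   Modulo 2 Z_(2) one has 2 B_{2d} = 1, so these are Cauchy-like matrices
   u_ij / (4 (X_i + Y_j)) with 2-adic units u_ij.  After a permutation of the
   rows each diagonal denominator is a power of 2 with strictly larger
   valuation than the entries before it in its row and column, so Gaussian
   elimination, pivoting from the last row upwards, never meets a zero pivot. *)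
Require Import Defs.
From mathcomp Require Import all_boot all_order all_algebra.
From mathcomp Require Import zify ring lra.

Set Implicit Arguments.
Unset Strict Implicit.
Unset Printing Implicit Defensive.

Import Order.TTheory GRing.Theory Num.Theory.
Local Open Scope ring_scope.

(** * The binomial recurrence, and the vanishing of B_k for odd k >= 3 *)

Lemma bernoulli_rec n :
  \sum_(i < n) 'C(n, i)%:R * bernoulli i = (n == 1%N)%:R :> rat.
Proof.
have := bernoulli_egf n; rewrite /fps_mul big_ord_recr /= subnn mul0r addr0.
move=> /(congr1 (fun a => n`!%:R * a)); rewrite mulr_sumr => eB.
have -> : (n == 1%N)%:R = n`!%:R * fps_t n :> rat.
  by rewrite /fps_t; case: eqP => [->|_]; rewrite ?mulr0 ?mulr1.
rewrite -eB; apply: eq_bigr => i _; have lt_in := ltn_ord i.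
have -> : fps_expm1 (n - i) = ((n - i)`!)%:R^-1.
  by rewrite /fps_expm1; case Dk: (n - i)%N => //; lia.
rewrite /egf -(bin_fact (ltnW lt_in)) !natrM.
have fact_neq0 k : (k`!)%:R != 0 :> rat by rewrite pnatr_eq0 -lt0n fact_gt0.
by field; rewrite !fact_neq0.
Qed.

Lemma bernoulli_rec_unique (B : nat -> rat) :
  (forall n, \sum_(i < n) 'C(n, i)%:R * B i = (n == 1%N)%:R) -> B =1 bernoulli.
Proof.
move=> recB n; elim/ltn_ind: n => n IH.
have := etrans (recB n.+1) (esym (bernoulli_rec n.+1)).
rewrite !big_ord_recr /= (eq_bigr (fun i : 'I_n => 'C(n.+1, i)%:R * bernoulli i)).
  by move/addrI; apply: mulfI; rewrite pnatr_eq0 -lt0n bin_gt0.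
by move=> i _; rewrite IH.
Qed.

(** The linear functional sending ['X^i] to B_i, truncated to degrees below [N] so that it is a
    finite sum. *)
Definition umbral (N : nat) (p : {poly rat}) : rat :=
  \sum_(i < N) p`_i * bernoulli i.

Lemma umbralXn N n : (n < N)%N -> umbral N 'X^n = bernoulli n.
Proof.
move=> lt_nN; rewrite /umbral (bigD1 (Ordinal lt_nN)) //= coefXn eqxx mul1r.
rewrite big1 ?addr0 // => i /negPf ne_in.
by rewrite coefXn (_ : (_ == _) = false) ?mul0r.
Qed.

Lemma umbral_lin N n (c : nat -> rat) (p : nat -> {poly rat}) :
  umbral N (\sum_(i < n) c i *: p i) = \sum_(i < n) c i * umbral N (p i).
Proof.
rewrite /umbral; under eq_bigr => i _ do rewrite coef_sum mulr_suml.
rewrite exchange_big; apply: eq_bigr => i _; rewrite mulr_sumr.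
by apply: eq_bigr => j _; rewrite coefZ -mulrA.
Qed.

Lemma umbral_shiftXn N n : (n < N)%N ->
  umbral N (('X + 1) ^+ n) = bernoulli n + (n == 1%N)%:R.
Proof.
move=> lt_nN.
have -> : ('X + 1) ^+ n = \sum_(i < n.+1) 'C(n, i)%:R *: 'X^i :> {poly rat}.
  rewrite addrC exprDn; apply: eq_bigr => i _.
  by rewrite expr1n mul1r scaler_nat.
rewrite (umbral_lin _ _ (fun i => 'C(n, i)%:R) (fun i => 'X^i)).
rewrite big_ord_recr /= binn mul1r umbralXn // addrC; congr (_ + _).
rewrite -bernoulli_rec; apply: eq_bigr => i _; rewrite umbralXn //.
exact: ltn_trans lt_nN.
Qed.

Lemma umbral_shift N (p : {poly rat}) : (size p <= N)%N ->
  umbral N (p \Po ('X + 1)) = umbral N p + p`_1.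
Proof.
move=> le_pN; rewrite comp_polyE.
rewrite (umbral_lin _ _ (fun i => p`_i) (fun i => ('X + 1) ^+ i)).
under eq_bigr => i _ do
  rewrite umbral_shiftXn ?(leq_trans (ltn_ord i)) // mulrDr.
rewrite big_split /=; congr (_ + _).
  rewrite /umbral (big_ord_widen N (fun i => p`_i * bernoulli i)) //.
  rewrite big_mkcond /=; apply: eq_bigr => i _.
  by case: ltnP => // /(nth_default 0) ->; rewrite mul0r.
have [lt1p|le_p1] := ltnP 1 (size p).
  rewrite (bigD1 (Ordinal lt1p)) //= mulr1 big1 ?addr0 // => i /negPf ne_i1.
  by rewrite (_ : (_ == _) = false) ?mulr0.
rewrite nth_default // big1 // => i _.
have lt_ip : (i < 1)%N := leq_trans (ltn_ord i) le_p1.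
have -> : ((i : nat) == 1%N) = false by lia.
by rewrite mulr0.
Qed.

(* The umbral form of t e^t / (e^t - 1) = B(-t). *)
Lemma bernoulli_reflection n :
  \sum_(i < n.+1) 'C(n, i)%:R * ((-1) ^+ i * bernoulli i) =
  (-1) ^+ n * bernoulli n + n%:R.
Proof.
have Dq : ('X - 1) ^+ n =
    \sum_(i < n.+1) ('C(n, i)%:R * (-1) ^+ (n - i)) *: 'X^i :> {poly rat}.
  rewrite addrC exprDn; apply: eq_bigr => i _.
  by rewrite -scalerA scaler_nat -[in RHS]mul_polyC rmorphXn rmorphN1.
have q1 : (('X - 1) ^+ n : {poly rat})`_1 = n%:R * (-1) ^+ n.-1.
  rewrite Dq coef_sum; case: n {Dq} => [|n].
    by rewrite big_ord1 coefZ coefXn mulr0 mul0r.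
  rewrite (bigD1 (Ordinal (isT : (1 < n.+2)%N))) //= coefZ coefX bin1 mulr1.
  rewrite subn1 big1 ?addr0 // => i /negPf ne_i1.
  by rewrite coefZ coefXn eq_sym (_ : (_ == _) = false) ?mulr0.
(* For this polynomial the shifted side collapses to ['X^n], while the other side expands into the
   alternating sum. *)
have := @umbral_shift n.+1 (('X - 1) ^+ n).
have -> : ('X - 1) ^+ n \Po ('X + 1) = 'X^n :> {poly rat}.
  by rewrite rmorphXn rmorphB rmorph1 /= comp_polyX addrK.
rewrite q1 -[X in 'X - X]polyC1 size_exp_XsubC polyC1 umbralXn // Dq.
move=> /(_ (leqnn _)).
rewrite (umbral_lin _ _ (fun i => 'C(n, i)%:R * (-1) ^+ (n - i))
  (fun i => 'X^i)).
move=> eqB.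
have -> : \sum_(i < n.+1) 'C(n, i)%:R * ((-1) ^+ i * bernoulli i) = (-1) ^+ n *
  \sum_(i < n.+1) 'C(n, i)%:R * (-1) ^+ (n - i) * umbral n.+1 'X^i.
  rewrite mulr_sumr; apply: eq_bigr => i _; rewrite umbralXn //.
  have le_in : (i <= n)%N by rewrite -ltnS.
  rewrite -[in (-1) ^+ n](subnK le_in) exprD.
  by have := sqrr_sign rat (n - i); rewrite /= expr2 => e; ring: e.
have -> : \sum_(i < n.+1) 'C(n, i)%:R * (-1) ^+ (n - i) * umbral n.+1 'X^i =
  bernoulli n - n%:R * (-1) ^+ n.-1 by rewrite eqB addrK.
rewrite mulrBr; congr (_ + _); case: n {Dq q1 eqB} => [|n].
  by rewrite mul0r mulr0 oppr0.
rewrite /= mulrCA exprS mulN1r mulNr -expr2 sqrr_sign; ring.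
Qed.

(** By reflection, (-1)^i B_i - [i = 1] obeys the same recurrence as B_i, so the two sequences
    agree; at an odd index from 3 on this reads -B = B. *)
Lemma bernoulli_odd k : bernoulli k.*2.+3 = 0.
Proof.
pose B i := (-1) ^+ i * bernoulli i - (i == 1%N)%:R.
have recB n : \sum_(i < n) 'C(n, i)%:R * B i = (n == 1%N)%:R.
  have := bernoulli_reflection n.
  rewrite big_ord_recr /= binn mul1r addrC => /addrI eqn.
  rewrite /B; under eq_bigr => i _ do rewrite mulrBr.
  rewrite big_split /= eqn sumrN; case: n {eqn} => [|[|n]].
  - by rewrite big_ord0 subrr.
  - by rewrite big_ord1 mulr0 subr0.
  rewrite (bigD1 (Ordinal (isT : (1 < n.+2)%N))) //= bin1 mulr1.
  rewrite big1 ?addr0 ?subrr // => i /negPf ne_i1.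
  by rewrite (_ : (_ == _) = false) ?mulr0.
have := bernoulli_rec_unique recB k.*2.+3.
rewrite /B subr0 -signr_odd /= odd_double expr1 => e; lra.
Qed.

(** * Arithmetic modulo 2 Z_(2) *)

(* The ideal 2 Z_(2) of the rationals with odd denominator. *)
Definition even2 (a : rat) : Prop :=
  exists p k : int, a * (2 * k%:~R + 1) = 2 * p%:~R.

Lemma odd_int_neq0 (k : int) : 2 * k%:~R + 1 != 0 :> rat.
Proof.
have -> : 2 * k%:~R + 1 = (2 * k + 1)%:~R :> rat by rewrite intrD intrM.
by rewrite intr_eq0; apply/eqP; lia.
Qed.

Lemma even2_2 : even2 2.
Proof. by exists 1, 0; rewrite mulr0 add0r mulr1. Qed.

Lemma even2D a b : even2 a -> even2 b -> even2 (a + b).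
Proof.
move=> [p [k ea]] [q [l eb]].
exists (p * (2 * l + 1) + q * (2 * k + 1)), (2 * k * l + k + l).
transitivity (a * (2 * k%:~R + 1) * (2 * l%:~R + 1) +
              b * (2 * l%:~R + 1) * (2 * k%:~R + 1)).
  by rewrite !(intrD, intrM); ring.
by rewrite ea eb !(intrD, intrM); ring.
Qed.

(** The residue field of Z_(2) is F_2, so [even2 (a - 1)] encodes that [a] is a 2-adic unit. *)
Lemma even2M1 a b : even2 (a - 1) -> even2 b -> even2 (a * b).
Proof.
move=> [p [k ea]] [q [l eb]].
exists ((2 * p + (2 * k + 1)) * q), (2 * k * l + k + l).
transitivity (((a - 1) * (2 * k%:~R + 1) + (2 * k%:~R + 1)) *
              (b * (2 * l%:~R + 1))).
  by rewrite !(intrD, intrM); ring.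
by rewrite ea eb !(intrD, intrM); ring.
Qed.

Lemma even2N a : even2 a -> even2 (- a).
Proof.
by move=> [p [k ea]]; exists (- p), k; rewrite mulNr ea mulrNz mulrN.
Qed.

Lemma even2B a b : even2 a -> even2 b -> even2 (a - b).
Proof. by move=> ea eb; apply: even2D => //; apply: even2N. Qed.

Lemma even2M a b : even2 a -> even2 b -> even2 (a * b).
Proof.
move=> ea eb; rewrite (_ : a * b = (a + 1) * b - b); last by ring.
by apply: even2B => //; apply: even2M1 => //; rewrite addrK.
Qed.

Lemma even2_intM (k : int) a : even2 a -> even2 (k%:~R * a).
Proof.
move=> [p [l ea]]; exists (k * p), l.
by rewrite -mulrA ea intrM; ring.
Qed.

Lemma even2_even (k : int) : even2 (2 * k%:~R).
Proof. by rewrite mulrC; apply/even2_intM/even2_2. Qed.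

Lemma even2_unit_neq0 a : even2 (a - 1) -> a != 0.
Proof.
move=> [p [k ea]]; apply: contraPneq ea => ->.
rewrite sub0r mulN1r => /eqP.
rewrite eq_sym -subr_eq0 opprK addrA -mulrDr -intrD.
exact/negP/odd_int_neq0.
Qed.

Lemma even2_unitM a b : even2 (a - 1) -> even2 (b - 1) -> even2 (a * b - 1).
Proof.
move=> ea eb; rewrite (_ : a * b - 1 = a * (b - 1) + (a - 1)); last by ring.
by apply: even2D => //; apply: even2M1.
Qed.

Lemma even2_unitV a : even2 (a - 1) -> even2 (a^-1 - 1).
Proof.
move=> ea; have a0 := even2_unit_neq0 ea; case: ea => [p [k ea]].
(* Here a = (2(p + k) + 1) / (2k + 1), and its numerator is the odd denominator of 1/a. *)
exists (- p), (p + k).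
have -> : 2 * (p + k)%:~R + 1 = a * (2 * k%:~R + 1) :> rat.
  by rewrite intrD mulrDr -ea; ring.
rewrite mulrA mulrBl mulVf // mul1r -opprB mulNr ea rmorphN; ring.
Qed.

(** * The residue of 2 B_{2d} modulo 2 *)

Lemma sum_bin_even n :
  \sum_(i < n.+2) ('C(n.+1, i) * ~~ odd i)%N = (2 ^ n)%N.
Proof.
have bin_sum (x : int) :
    (1 + x) ^+ n.+1 = \sum_(i < n.+2) 'C(n.+1, i)%:R * x ^+ i.
  by rewrite exprDn; apply: eq_bigr => i _; rewrite expr1n mul1r mulr_natl.
(* Adding the expansion of (1 - 1)^(n+1) = 0 cancels the odd terms and doubles the even ones. *)
have : (1 + 1) ^+ n.+1 = \sum_(i < n.+2) 'C(n.+1, i)%:R * 1 ^+ i +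
    \sum_(i < n.+2) 'C(n.+1, i)%:R * (-1) ^+ i :> int.
  by rewrite -!bin_sum subrr expr0n addr0.
rewrite -big_split /= => sum2.
apply/eqP; rewrite -(eqn_pmul2l (isT : 0 < 2)%N) -expnS -(eqr_nat int).
rewrite natrM natrX -[2%:R]/(1 + 1 : int) sum2 natr_sum mulr_sumr eq_sym.
apply/eqP/eq_bigr => i _; rewrite expr1n -signr_odd natrM.
by case: (odd i); rewrite /= ?expr0 ?expr1; ring.
Qed.

(* The case p = 2 of the von Staudt-Clausen theorem. *)
Lemma bernoulli_even2 k : even2 (2 * bernoulli k.*2.+2 - 1).
Proof.
elim/ltn_ind: k => k IH; set m := k.*2.+2.
(* [e i] is the residue of 2 B_i modulo 2. *)
pose e i : nat := (~~ odd i - (i == 0) + (i == 1))%N.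
have even_e i : (i < m)%N -> even2 (2 * bernoulli i - (e i)%:R).
  rewrite /e; case: i => [|[|i]] lt_im.
  - have := bernoulli_rec 1; rewrite big_ord1 mul1r => -> /=.
    by rewrite subr0 mulr1; apply: even2_2.
  - by rewrite bernoulli1 (_ : _ - _ = - 2) //; apply/even2N/even2_2.
  rewrite /= subn0 addn0 negbK; have := odd_double_half i.
  case: (odd i) => /= Di; rewrite -Di in lt_im *.
    by rewrite bernoulli_odd mulr0 subr0; have := even2_even 0; rewrite mulr0.
  by apply: IH; rewrite /m in lt_im; lia.
(* Compared with the sum over even indices, the term 1 at 0 and the term m + 1 at m are lost, and m
   + 1 is gained at index 1. *)
have sum_e : (\sum_(i < m) 'C(m.+1, i) * e i)%N = (2 ^ m).-1.
  have := sum_bin_even m; rewrite 2!big_ord_recr /=.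
  rewrite binn binSn odd_double /=.
  rewrite /m !big_ord_recl /= /e /= bin0 bin1 !muln1 muln0.
  move=> sumE; under eq_bigr => i _ do rewrite subn0 addn0.
  move: sumE; set S := \big[_/_]_(i < _) _.
  by move: S => S sumE; lia.
have := bernoulli_rec m.+1; rewrite big_ord_recr /= binSn => recm.
have e_diff : even2 (\sum_(i < m) 'C(m.+1, i)%:R *
    (2 * bernoulli i - (e i)%:R)).
  elim/big_ind: _ => [|a b|i _]; last 1 first.
  - by rewrite pmulrn; apply/even2_intM/even_e.
  - by have := even2_even 0; rewrite mulr0.
  exact: even2D.
have m1 : even2 (m.+1%:R - 1).
  have -> : m.+1%:R - 1 = 2 * k.+1%:Z%:~R :> rat.
    by rewrite -natr1 addrK /m -doubleS -mul2n natrM.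
  exact: even2_even.
(* Twice the recurrence, with each 2 B_i replaced by its residue, gives -(2^m - 1), which is 1
   modulo 2. *)
have prod1 : even2 (m.+1%:R * (2 * bernoulli m) - 1).
  have -> : m.+1%:R * (2 * bernoulli m) - 1 =
    - (\sum_(i < m) 'C(m.+1, i)%:R * (2 * bernoulli i - (e i)%:R)) - (2 ^ m)%:R.
    under eq_bigr => i _ do rewrite mulrBr -natrM mulrCA.
    rewrite sumrB -mulr_sumr -natr_sum sum_e -subn1 natrB ?expn_gt0 //.
    move/eqP: recm; rewrite addr_eq0 => /eqP ->; ring.
  apply: even2B; first exact: even2N.
  by rewrite expnS natrM; apply: (even2_even (2 ^ k.*2.+1)%N).
have m0 := even2_unit_neq0 m1.
rewrite (_ : 2 * bernoulli m = m.+1%:R * (2 * bernoulli m) * m.+1%:R^-1).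
  by apply: even2_unitM => //; apply: even2_unitV.
by rewrite mulrAC mulfV // mul1r.
Qed.

(** * Elimination in Cauchy-like matrices *)

(* Elimination of the last unknown: the cross ratio d_ss d_ij / (d_is d_sj) of
   the d_ij = X_i + Y_j lies in [even2], so the new coefficients have the same
   shape, with the same denominators. *)
Lemma cauchy_pivot_kernel (n : nat) (X Y : nat -> rat) (u : nat -> nat -> rat)
    (x : nat -> rat) :
  (forall i j, (i < n)%N -> (j < n)%N -> even2 (u i j - 1)) ->
  (forall i j, (i < n)%N -> (j < n)%N -> X i + Y j != 0) ->
  (forall t s, (t < s < n)%N -> even2 ((X s + Y s) / (X s + Y t)) /\
                                even2 ((X s + Y s) / (X t + Y s))) ->
  (forall i, (i < n)%N -> \sum_(j < n) u i j / (X i + Y j) * x j = 0) ->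
  forall j, (j < n)%N -> x j = 0.
Proof.
elim: n u => // n IH u u1 d0 piv ker.
have un0 := even2_unit_neq0 (u1 n n (leqnn _) (leqnn _)).
have dn0 := d0 n n (leqnn _) (leqnn _).
have xn : x n =
    - ((X n + Y n) / u n n * \sum_(j < n) u n j / (X n + Y j) * x j).
  have := ker n (leqnn _); rewrite big_ord_recr /=.
  move/eqP; rewrite addr_eq0 => /eqP ->; field; by rewrite un0 dn0.
pose r i j := (X n + Y n) * (X i + Y j) / ((X i + Y n) * (X n + Y j)).
(* [v i j / (X i + Y j)] is the entry of the Schur complement of the pivot [(n, n)]. *)
pose v i j := u i j - u i n * (u n j * ((u n n)^-1 * r i j)).
have x0 : forall j, (j < n)%N -> x j = 0.
  apply: (IH v) => [i j lt_in lt_jn|i j lt_in lt_jn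
                   |t s /andP[lt_ts lt_sn]|i lt_in].
  - have d_in0 := d0 i n (ltnW lt_in) (leqnn _).
    have d_nj0 := d0 n j (leqnn _) (ltnW lt_jn).
    have [|e1 _] := piv j n; first by rewrite lt_jn leqnn.
    have [|_ e2] := piv i n; first by rewrite lt_in leqnn.
    rewrite /v addrAC; apply: even2B; first by apply: u1; apply: ltnW.
    apply: even2M1; first by apply: u1 => //; apply: ltnW.
    apply: even2M1; first by apply: u1 => //; apply: ltnW.
    apply: even2M1; first by apply/even2_unitV/u1.
    (* This rests on d_ij = d_in + d_nj - d_nn. *)
    have -> : r i j = (X n + Y n) / (X n + Y j) + (X n + Y n) / (X i + Y n)
        - (X n + Y n) / (X n + Y j) * ((X n + Y n) / (X i + Y n)).
      by rewrite /r; field; rewrite d_in0 d_nj0.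
    by apply: even2B; [apply: even2D | apply: even2M].
  - by apply: d0; apply: ltnW.
  - by apply: piv; rewrite lt_ts ltnW.
  have := ker i (ltnW lt_in); rewrite big_ord_recr /= => kerE.
  rewrite -[RHS]kerE.
  have d_in0 := d0 i n (ltnW lt_in) (leqnn _).
  rewrite xn mulrN mulrA mulr_sumr -sumrB; apply: eq_bigr => j _.
  have d_ij0 := d0 i j (ltnW lt_in) (ltnW (ltn_ord j)).
  have d_nj0 := d0 n j (leqnn _) (ltnW (ltn_ord j)).
  by rewrite /v /r; field; rewrite d_in0 d_ij0 d_nj0 un0.
move=> j; rewrite ltnS leq_eqVlt => /orP[/eqP->|]; last exact: x0.
rewrite xn big1 ?mulr0 ?oppr0 // => i _; by rewrite x0 ?mulr0.
Qed.

(** * Pivots that are powers of 2 *)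

(** The only multiple of 2^r strictly between 0 and 2^(r+1) is 2^r itself, so [k] has smaller
    valuation. *)
Lemma even2_pow2_div r k : (0 < k)%N -> (k < 2 ^ r.+1)%N -> k != (2 ^ r)%N ->
  even2 ((2 ^ r)%:R / k%:R).
Proof.
move=> k_gt0 lt_kr ne_kr.
have [q q_odd Dk] := pfactor_coprime (isT : prime 2) k_gt0.
rewrite coprime2n in q_odd.
set f := logn 2 k in Dk.
have q_gt0 : (0 < q)%N by case: (q) q_odd.
have lt_fr : (f < r)%N.
  rewrite ltnNge; apply/negP; rewrite leq_eqVlt => /orP[/eqP rf|lt_rf].
    case: q q_odd Dk {q_gt0} => [|[|[|q]]] // _ Dk.
      by rewrite Dk mul1n -rf eqxx in ne_kr.
    by move: lt_kr; rewrite Dk -rf expnS; have := expn_gt0 2 r; nia.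
  have := leq_pexp2l (isT : 0 < 2)%N lt_rf; move: lt_kr; rewrite Dk; nia.
exists (2 ^ (r - f.+1))%N, q./2.
have -> : 2 * q./2%:Z%:~R + 1 = q%:R :> rat.
  have Dq : q = (2 * q./2 + 1)%N by lia.
  by rewrite [in RHS]Dq (natrD _ (2 * _)) (natrM _ 2%N).
have -> : (2 ^ r = 2 * 2 ^ (r - f.+1) * 2 ^ f)%N.
  by rewrite -expnS -expnD; congr (2 ^ _)%N; lia.
have q0 : q%:R != 0 :> rat by rewrite pnatr_eq0 -lt0n.
have p0 : (2 ^ f)%:R != 0 :> rat by rewrite pnatr_eq0 expn_eq0.
rewrite Dk (natrM _ q) (natrM _ (2 * _)%N) natrM -pmulrn.
by move: (2 ^ f)%:R q%:R p0 q0 => a b a0 b0; field; rewrite a0 b0.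
Qed.

(* The permutation [s] reflects the upper part of the indices through the
   largest available power of 2, and recursively the remaining lower part. *)
Lemma pow2_matching c m : (0 < c <= 2)%N ->
  exists s : nat -> nat, (forall i, (i < m)%N -> (s i < m)%N) /\
  forall j i, (j < i < m)%N -> exists r,
    [/\ s i + i + c = 2 ^ r,
        s i + j + c != 2 ^ r, s j + i + c != 2 ^ r,
        s i + j + c < 2 ^ r.+1 & s j + i + c < 2 ^ r.+1]%N.
Proof.
move=> c_bnd; elim/ltn_ind: m => m IH.
have [->|m_gt0] := posnP m; first by exists id; split=> // j i; rewrite andbC.
(* [K] is the largest value of i + j + c. The indices from [m'] to [m - 1] are reflected by i -> N -
   c - i; since c <= 2, K < 2N forces m - 1 + c <= N, so no subtraction truncates. *)
pose K := (2 * (m - 1) + c)%N; pose r := trunc_log 2 K.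
have /andP[le_rK lt_Kr] : (2 ^ r <= K < 2 ^ r.+1)%N.
  by apply: trunc_log_bounds => //; rewrite /K; lia.
have even_r : (2 ^ r.+1 = 2 * 2 ^ r)%N by rewrite expnS.
set N := (2 ^ r)%N in le_rK lt_Kr even_r.
pose m' := (N - c - (m - 1))%N.
have [|s [s_lt s_piv]] := IH m'; first by rewrite /m' /K in le_rK *; lia.
exists (fun i => if (i < m')%N then s i else (N - c - i)%N).
split=> [i lt_im|j i].
  have [lt_im'|le_m'i] := ltnP i m'; first have := s_lt i lt_im'.
    by rewrite /m' /K in lt_Kr le_rK *; lia.
  by rewrite /m' /K in lt_Kr le_rK le_m'i *; lia.
move=> /andP[lt_ji lt_im]; have [lt_im'|le_m'i] := ltnP i m'.
  by rewrite (ltn_trans lt_ji lt_im'); apply: s_piv; rewrite lt_ji.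
(* For a reflected [i], s i + j + c falls short of [N]; so does s j + i + c when j < m', and
   otherwise it exceeds [N] by i - j. *)
exists r; rewrite even_r -/N.
have N_gt : (m + c <= N.+1)%N by rewrite /K in lt_Kr; lia.
have [lt_jm'|le_m'j] := ltnP j m'; first have := s_lt j lt_jm'.
  by rewrite /m' /K in lt_Kr le_rK le_m'i *; split; lia.
by rewrite /m' /K in lt_Kr le_rK le_m'i le_m'j *; split; lia.
Qed.

(** * The kernel of the Hankel matrix of [mu] *)

Lemma muE d : mu d.*2.+1 = (2 * bernoulli d.*2.+2) / (4 * d.+1%:R).
Proof.
rewrite /mu -doubleS -[in d.+1.*2%:R]mul2n natrM.
have : d.+1%:R != 0 :> rat by rewrite pnatr_eq0.
by move: (bernoulli _) d.+1%:R => b k k0; field.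
Qed.

Lemma mu_hankel_kernel c m (x : nat -> rat) : (c < 2)%N ->
  (forall i, (i < m)%N -> \sum_(j < m) mu (i + j + c).*2.+1 * x j = 0) ->
  forall j, (j < m)%N -> x j = 0.
Proof.
move=> c_lt2 ker; have [|s [s_lt s_piv]] := @pow2_matching c.+1 m; first by lia.
pose X i : rat := (s i + c.+1)%:R; pose Y j : rat := j%:R.
pose u i j := 2 * bernoulli (s i + j + c).*2.+2.
have dE i j : X i + Y j = (s i + j + c.+1)%:R.
  by rewrite /X /Y -natrD addnAC.
apply: (@cauchy_pivot_kernel m X Y u) => [i j _ _|i j _ _|j i|i lt_im].
- exact: bernoulli_even2.
- by rewrite dE pnatr_eq0 addnS.
- move=> /s_piv[r [e2r ne1 ne2 lt1 lt2]].
  by rewrite !dE e2r; split; apply: even2_pow2_div => //; rewrite addnS.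
apply: (mulfI (_ : 4^-1 != 0 :> rat)) => //.
rewrite mulr0 -[RHS](ker _ (s_lt _ lt_im)) mulr_sumr; apply: eq_bigr => j _.
by rewrite muE dE addnS /u invfM; ring.
Qed.

Lemma mu_even k : mu k.+1.*2 = 0.
Proof. by rewrite /mu doubleS bernoulli_odd mul0r. Qed.

Lemma mu0_neq0 : mu 0 != 0.
Proof. by rewrite /mu bernoulli1. Qed.

Lemma sum_parity (R : nmodType) (F : nat -> R) k :
  \sum_(i < k) F i =
  \sum_(a < uphalf k) F a.*2 + \sum_(a < k./2) F a.*2.+1.
Proof.
elim: k => [|k IH]; first by rewrite !big_ord0 addr0.
rewrite big_ord_recr IH /= uphalf_half; have := odd_double_half k.
case: (odd k) => /= Dk.
  by rewrite !add1n big_ord_recr [in RHS]big_ord_recr /= -addrA -[in F k]Dk.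
by rewrite !add0n big_ord_recr /= addrAC -[in F k]Dk.
Qed.

(** Odd rows involve only unknowns of even index, and even rows only those of odd index, except that
    row 0 also contains [mu 0 * x 0]. *)
Lemma mu_hankel_kernel_full n (x : nat -> rat) :
  (forall j, (j < n)%N -> \sum_(i < n) mu (j + i) * x i = 0) ->
  forall i, (i < n)%N -> x i = 0.
Proof.
move=> ker.
have odd_row b : (b.*2.+1 < n)%N ->
    \sum_(a < uphalf n) mu (b + a).*2.+1 * x a.*2 = 0.
  move/ker; rewrite (sum_parity (fun i => mu (b.*2.+1 + i) * x i)).
  rewrite [X in _ + X]big1 ?addr0 => [rowE|a _]; last first.
    by rewrite (_ : b.*2.+1 + _ = (b + a).+1.*2)%N ?mu_even ?mul0r //; lia.
  by rewrite -[RHS]rowE; apply: eq_bigr => a _; rewrite addSn doubleD.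
have even_row b : (b.*2 < n)%N -> ((b == 0)%N ==> (x 0%N == 0)) ->
    \sum_(a < n./2) mu (b + a).*2.+1 * x a.*2.+1 = 0.
  move=> lt_bn b_x0; have := ker _ lt_bn.
  rewrite (sum_parity (fun i => mu (b.*2 + i) * x i)).
  rewrite big1 ?add0r => [rowE|[[|a] /= _] _].
  - by rewrite -[RHS]rowE; apply: eq_bigr => a _; rewrite addnS doubleD.
  - case: b b_x0 {lt_bn} => [/eqP->|b _]; first by rewrite mulr0.
    by rewrite addn0 mu_even mul0r.
  - by rewrite -doubleD addnS mu_even mul0r.
have := odd_double_half n; rewrite uphalf_half in odd_row.
move: (n./2) odd_row even_row => m odd_row even_row.
move=> Dn.
suff [x_even x_odd] : (forall a, (a < odd n + m)%N -> x a.*2 = 0) /\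
    (forall a, (a < m)%N -> x a.*2.+1 = 0).
  move=> i lt_in; rewrite -(odd_double_half i).
  have := odd_double_half i; case: (odd i) => Di; first by apply: x_odd; lia.
  by apply: x_even; lia.
(* For n = 2m + 1, the even rows after row 0 kill the odd unknowns, row 0 then kills [x 0], and the
   odd rows kill the other even unknowns. *)
case: (odd n) Dn odd_row => /= Dn odd_row.
  have x_odd a : (a < m)%N -> x a.*2.+1 = 0.
    apply: (@mu_hankel_kernel 1 m (fun a => x a.*2.+1)) => // b lt_bm.
    have row : (b.+1.*2 < n)%N by lia.
    rewrite -[RHS](even_row _ row isT); apply: eq_bigr => i _.
    by rewrite addn1.
  have x0 : x 0%N = 0.
    have n_gt0 : (0 < n)%N by lia.
    have := ker _ n_gt0; rewrite (sum_parity (fun i => mu (0 + i) * x i)).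
    have [-> ->] : uphalf n = m.+1 /\ n./2 = m by rewrite uphalf_half; lia.
    rewrite big_ord_recl /=.
    rewrite big1 => [|i _]; last by rewrite /bump mu_even mul0r.
    rewrite addr0 big1 => [|i _]; last by rewrite x_odd ?mulr0.
    by rewrite addr0 => /eqP; rewrite mulf_eq0 (negPf mu0_neq0) => /eqP.
  split=> // -[|a] lt_am //.
  apply: (@mu_hankel_kernel 1 m (fun a => x a.+1.*2)) => // b lt_bm.
  have row : (b.*2.+1 < n)%N by lia.
  rewrite -[RHS](odd_row _ row) big_ord_recl x0 mulr0 add0r.
  by apply: eq_bigr => i _; rewrite addn1 addnS.
(* For n = 2m, the odd rows come first: they give [x 0 = 0], which makes row 0 usable for the odd
   unknowns. *)
have x_even a : (a < m)%N -> x a.*2 = 0.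
  apply: (@mu_hankel_kernel 0 m (fun a => x a.*2)) => // b lt_bm.
  have row : (b.*2.+1 < n)%N by lia.
  by rewrite -[RHS](odd_row _ row); apply: eq_bigr => i _; rewrite addn0.
split=> // a lt_am.
apply: (@mu_hankel_kernel 0 m (fun a => x a.*2.+1)) => // b lt_bm.
have row : (b.*2 < n)%N by lia.
have x0 : x 0%N = 0 by apply: (x_even 0%N); lia.
rewrite -[RHS](even_row _ row); last by rewrite x0 eqxx implybT.
by apply: eq_bigr => i _; rewrite addn0.
Qed.

Theorem proposition16 (n : nat) : hankel_det mu n != 0.
Proof.
apply/negP => /det0P[v v_neq0 vH]; case/negP: v_neq0.
pose x i : rat := if insub i is Some k then v 0 k else 0.
have xE (i : 'I_n.+1) : x i = v 0 i by rewrite /x valK.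
apply/eqP/rowP => i; rewrite mxE -xE.
apply: (mu_hankel_kernel_full _ (ltn_ord i)) => j lt_jn.
have /matrixP/(_ 0 (Ordinal lt_jn)) := vH; rewrite !mxE => vHj.
rewrite -[RHS]vHj; apply: eq_bigr => k _.
by rewrite mxE xE mulrC addnC.
Qed.
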